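(* Let $E/K$ be a finite Galois extension of fields with Galois group $(G,\cdot)$, let $L$ be an intermediate field with $G'=\mathrm{Gal}(E/L)$, and let $X=G/G'$ be the left coset space, with $\bar x=xG'$. Let $\star$ be a binary operation on $X$ such that $(G,\cdot,X,\star,\odot)$ is a skew bracoid, where $\odot$ is left translation of cosets, and let $H=E[X,\star]^G$ give the corresponding Hopf-Galois structure on $L/K$. (1) There is a bijection between intermediate fields $F$ of $L/K$ that are realizable with respect to $H$ and left ideals $Y$ of $(G,X)$. (2) Writing $L^Y$ for the intermediate field corresponding to a left ideal $Y$, we have $L^Y=E^{G_Y}$. (3) The Hopf-Galois structure given by $H$ on $L/K$ yields a quotient Hopf-Galois structure on $L^Y/K$ if and only if $Y$ is an ideal of $(G,X)$. (4) The extension $L^Y/K$ is a Galois extension if and only if $Y$ is an enhanced left ideal of $(G,X)$.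
   Context: A (left) skew bracoid is a $5$-tuple $(G,\cdot,N,\star,\odot)$, also written $(G,N)$, such that $(G,\cdot)$ and $(N,\star)$ are groups and $\odot$ is a transitive action of $(G,\cdot)$ on the set $N$ such that $g\odot(\eta\star\mu)=(g\odot\eta)\star(g\odot e_N)^{-1}\star(g\odot\mu)$ for all $g\in G$ and $\eta,\mu\in N$, where $e_N$ is the identity of $N$ and inverses of elements of $N$ are taken in $(N,\star)$. Its $\gamma$-function is the homomorphism $\gamma:G\to\mathrm{Aut}(N)$ given by ${}^{\gamma(g)}\eta=(g\odot e_N)^{-1}\star(g\odot\eta)$. A left ideal of $(G,N)$ is a subgroup $M$ of $N$ with ${}^{\gamma(G)}M=M$; an ideal is a left ideal that is normal in $N$. For a left ideal $M$, $G_M=\{g\in G\mid g\odot\mu\in M\text{ for all }\mu\in M\}$, a subgroup of $G$. An enhanced left ideal is a left ideal $M$ such that $G_M$ is normal in $G$. Left translation of cosets is $g\odot\bar x=\overline{gx}$. A Hopf-Galois structure on the finite extension $L/K$ consists of a $K$-Hopf algebra $H$ and a $K$-linear action of $H$ on $L$ making $L$ an $H$-module algebra and such that the map $L\otimes_K H\to\mathrm{End}_K(L)$, $\ell\otimes h\mapsto(t\mapsto\ell\,h(t))$, is bijective. The Hopf-Galois structure on $L/K$ corresponding to $(G,\cdot,X,\star,\odot)$ is given by the $K$-Hopf algebra $H=E[X,\star]^G$, the fixed points of the group algebra $E[X,\star]$ (with its usual Hopf algebra structure) under the action of $G$ that acts on $E$ by Galois automorphisms and on $X$ via $\gamma$;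 it acts on $L$ by $\left(\sum_{\bar x\in X}c_{\bar x}\bar x\right)[t]=\sum_{\bar x\in X}c_{\bar x}\,\bar x(t)$ for $t\in L$, where $\bar x(t)=x(t)$ (well defined since $L=E^{G'}$). For a Hopf subalgebra $H'$ of $H$, its fixed field is $L^{H'}=\{t\in L\mid h(t)=\varepsilon(h)t\text{ for all }h\in H'\}$, where $\varepsilon$ is the counit of $H$. An intermediate field of $L/K$ is realizable with respect to $H$ if it equals $L^{H'}$ for some Hopf subalgebra $H'$ of $H$. The Hopf subalgebra of $H$ corresponding to a left ideal $Y$ of $(G,X)$ is $E[Y,\star]^G$, and the intermediate field corresponding to $Y$ is its fixed field $L^Y=L^{E[Y,\star]^G}$. The Hopf-Galois structure given by $H$ on $L/K$ is said to yield a quotient Hopf-Galois structure on $L^{H'}/K$ when $H'$ is a normal Hopf subalgebra of $H$ (i.e. stable under the adjoint actions of $H$), in which case the quotient Hopf algebra of $H$ by $H'$ acts naturally on $L^{H'}$. For a subgroup $S\le G$, $E^S$ is the fixed field of $S$ in the usual Galois sense. *)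

(* Defs.v *)
From HB Require Import structures.
From mathcomp Require Import all_boot all_fingroup all_algebra all_field.

Set Implicit Arguments.
Unset Strict Implicit.
Unset Printing Implicit Defensive.

Import GroupScope GRing.Theory.
Local Open Scope ring_scope.

Record group_law (T : Type) (star : T -> T -> T) := GroupLaw {
  law_one : T;
  law_inv : T -> T;
  law_mulA : associative star;
  law_mul1 : left_id law_one star;
  law_mulV : left_inverse law_one law_inv star
}.

Definition law_group (T : finType) (star : T -> T -> T)
  (S : group_law star) : Type := T.

HB.instance Definition _ (T : finType) (star : T -> T -> T)
  (S : group_law star) := Finite.copy (law_group S) T.
HB.instance Definition _ (T : finType) (star : T -> T -> T)
  (S : group_law star) :=
  Finite_isGroup.Build (law_group S)
    (law_mulA S) (law_mul1 S) (law_mulV S).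

Section SkewBracoid.

Variables (gT nT : finGroupType) (act : gT -> nT -> nT).

Record skew_bracoid : Prop := SkewBracoid {
  sb_act1 : forall x : nT, act 1%g x = x;
  sb_actM : forall (g h : gT) (x : nT), act (g * h)%g x = act g (act h x);
  sb_trans : forall x y : nT, exists g : gT, act g x = y;
  sb_rel : forall (g : gT) (x y : nT),
    act g (x * y)%g = (act g x * (act g 1)^-1 * act g y)%g
}.

Definition gamma (g : gT) (x : nT) : nT := ((act g 1)^-1 * act g x)%g.

Definition left_ideal (M : {group nT}) : bool :=
  gamma @2: ([set: gT], M) == M.

Definition ideal (M : {group nT}) : bool :=
  left_ideal M && (M <| [set: nT])%g.

Definition ideal_stab (M : {set nT}) : {set gT} :=
  [set g | [forall x in M, act g x \in M]].

Definition enhanced_left_ideal (M : {group nT}) : bool :=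
  left_ideal M && (ideal_stab M <| [set: gT])%g.

End SkewBracoid.

Section CosetSpace.

Variables (gT : finGroupType) (H : {group gT}).

Definition coset_space : Type :=
  {C : {set gT} | C \in lcosets H [set: gT]}.
HB.instance Definition _ := Finite.copy coset_space
  {C : {set gT} | C \in lcosets H [set: gT]}.

Lemma ltrans_subproof (g : gT) (C : coset_space) :
  (g *: val C)%g \in lcosets H [set: gT].
Proof.
case: C => C /= /lcosetsP[x _ ->]; rewrite -lcosetM.
by apply/lcosetsP; exists (g * x)%g.
Qed.

Definition ltrans (g : gT) (C : coset_space) : coset_space :=
  Sub (g *: val C)%g (ltrans_subproof g C).

End CosetSpace.

(** The Galois group under composition of maps.  The product of [gal_of] is
    composition in the opposite order: [(x * y) t = y (x t)] by [galM]. *)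

Section GaloisGroup.

Variables (K : fieldType) (E : splittingFieldType K).

Definition galc : Type := gal_of {:E}.
HB.instance Definition _ := Finite.copy galc (gal_of {:E}).

Definition galc_mul (g h : galc) : galc :=
  ((h : gal_of {:E}) * (g : gal_of {:E}))%g.
Definition galc_one : galc := (1 : gal_of {:E})%g.
Definition galc_inv (g : galc) : galc := ((g : gal_of {:E})^-1)%g.

Fact galc_mulA : associative galc_mul.
Proof. by move=> f g h; rewrite /galc_mul mulgA. Qed.
Fact galc_mul1 : left_id galc_one galc_mul.
Proof. by move=> g; rewrite /galc_mul mulg1. Qed.
Fact galc_mulV : left_inverse galc_one galc_inv galc_mul.
Proof. by move=> g; rewrite /galc_mul mulgV. Qed.

HB.instance Definition _ :=
  Finite_isGroup.Build galc galc_mulA galc_mul1 galc_mulV.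

Definition galc_app (g : galc) (t : E) : E := (g : gal_of {:E}) t.

Lemma galc_appM (g h : galc) (t : E) :
  galc_app (g * h)%g t = galc_app g (galc_app h t).
Proof. by rewrite /galc_app -galM ?memvf. Qed.

Definition galc_fix (L : {subfield E}) : {set galc} :=
  [set g : galc | (g : gal_of {:E}) \in 'Gal({:E} / L)%g].

Fact galc_fix_group_set (L : {subfield E}) : group_set (galc_fix L).
Proof.
apply/group_setP; split=> [|g h]; rewrite !inE; first exact: group1.
by move=> Gg Gh; apply: groupM.
Qed.
Canonical galc_fix_group L := Group (galc_fix_group_set L).

Definition galc_fixed_field (A : {set galc}) : {vspace E} :=
  fixedField (A : {set gal_of {:E}}).

End GaloisGroup.

(** The group algebra [E[N]], with [a : {ffun N -> E}] standing for the sum of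
    the [a x . x]; [E[N] (x)_E E[N]] is [{ffun N * N -> E}]. *)

Section GroupAlgebra.

Variables (K : fieldType) (E : fieldExtType K) (N : finGroupType).
Implicit Types (a b : {ffun N -> E}) (V : {vspace {ffun N -> E}}).

Definition ga_scale (c : E) a : {ffun N -> E} := [ffun x => c * a x].
Definition ga_delta (x : N) : {ffun N -> E} := [ffun y => (y == x)%:R].
Definition ga_one : {ffun N -> E} := ga_delta 1%g.
Definition ga_mul a b : {ffun N -> E} :=
  [ffun z => \sum_(p : N * N | (p.1 * p.2)%g == z) a p.1 * b p.2].
Definition ga_counit a : E := \sum_x a x.
Definition ga_antipode a : {ffun N -> E} := [ffun x => a x^-1%g].
Definition ga_tensor a b : {ffun N * N -> E} :=
  [ffun p : N * N => a p.1 * b p.2].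
Definition ga_comul a : {ffun N * N -> E} :=
  \sum_x [ffun p => a x * ga_tensor (ga_delta x) (ga_delta x) p].

(** The adjoint actions [h_(1) a S(h_(2))] and [S(h_(1)) a h_(2)], the tensor
    [ga_comul h] being expanded on the [E]-basis of group elements. *)
Definition ga_adl h a : {ffun N -> E} :=
  \sum_(p : N * N) ga_scale (ga_comul h p)
    (ga_mul (ga_mul (ga_delta p.1) a) (ga_antipode (ga_delta p.2))).
Definition ga_adr h a : {ffun N -> E} :=
  \sum_(p : N * N) ga_scale (ga_comul h p)
    (ga_mul (ga_mul (ga_antipode (ga_delta p.1)) a) (ga_delta p.2)).

(** The image of [V (x)_K V] in [E[N] (x)_E E[N]].  The spaces [V] used below
    consist of fixed points of a semilinear action of the Galois group, so that
    a [K]-free family in [V] is [E]-free and [V (x)_K V] is isomorphic to this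
    image. *)
Definition tensor_square V : {vspace {ffun N * N -> E}} :=
  <<[seq ga_tensor a b | a <- vbasis V, b <- vbasis V]>>%VS.

Definition hopf_closed V : Prop :=
  [/\ ga_one \in V,
      {in V &, forall a b, ga_mul a b \in V},
      {in V, forall a, ga_antipode a \in V}
    & {in V, forall a, ga_comul a \in tensor_square V}].

Definition hopf_subalgebra (H V : {vspace {ffun N -> E}}) : Prop :=
  (V <= H)%VS /\ hopf_closed V.

Definition normal_hopf_subalgebra (H V : {vspace {ffun N -> E}}) : Prop :=
  hopf_subalgebra H V /\
  forall h a, h \in H -> a \in V -> ga_adl h a \in V /\ ga_adr h a \in V.

End GroupAlgebra.

Section Descent.

Variables (K : fieldType) (E : splittingFieldType K) (N : finGroupType).
Variable act : galc E -> N -> N.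

Definition ga_act (g : galc E) (a : {ffun N -> E}) : {ffun N -> E} :=
  [ffun y => \sum_(x | gamma act g x == y) galc_app g (a x)].

Fact ga_act_is_linear g : linear (ga_act g).
Proof.
move=> k a b; apply/ffunP=> y; rewrite !ffunE scaler_sumr -big_split /=.
by apply: eq_bigr => x _; rewrite !ffunE /galc_app linearP.
Qed.
HB.instance Definition _ g :=
  GRing.isLinear.Build K {ffun N -> E} {ffun N -> E} _ (ga_act g)
    (ga_act_is_linear g).

Definition ga_coef (x : N) (a : {ffun N -> E}) : E := a x.

Fact ga_coef_is_linear x : linear (ga_coef x).
Proof. by move=> k a b; rewrite /ga_coef !ffunE. Qed.
HB.instance Definition _ x :=
  GRing.isLinear.Build K {ffun N -> E} E _ (ga_coef x) (ga_coef_is_linear x).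

(** [E[M]^G], as a [K]-subspace of [E[N]]. *)
Definition ga_fixed (M : {set N}) : {vspace {ffun N -> E}} :=
  (\bigcap_(g : galc E) fixedSpace (linfun (ga_act g)) :&:
   \bigcap_(x | x \notin M) lker (linfun (ga_coef x)))%VS.

Lemma ga_fixedP (M : {set N}) (a : {ffun N -> E}) :
  reflect ((forall g, ga_act g a = a) /\ (forall x, x \notin M -> a x = 0))
          (a \in ga_fixed M).
Proof.
rewrite memv_cap; apply: (iffP andP) => [[/subv_bigcapP Ga /subv_bigcapP Ma]|].
  split=> [g | x Mx].
    by have:= Ga g isT; rewrite -memvE => /fixedSpaceP; rewrite lfunE.
  by have:= Ma x Mx; rewrite -memvE memv_ker lfunE => /eqP.
case=> Ga Ma; split; apply/subv_bigcapP=> x Mx; rewrite -memvE.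
  by apply/fixedSpaceP; rewrite lfunE /= Ga.
by rewrite memv_ker lfunE /= /ga_coef Ma.
Qed.

End Descent.

Section HopfGalois.

Variables (K : fieldType) (E : splittingFieldType K) (L : {subfield E}).

Definition galX : finType := coset_space (galc_fix_group L).

(** [x(t)], which does not depend on the representative when [t] is in [L]. *)
Definition coset_app (x : galX) (t : E) : E := galc_app (repr (val x)) t.

Lemma coset_appE (x : galX) (g : galc E) (t : E) :
  g \in val x -> t \in L -> coset_app x t = galc_app g t.
Proof.
rewrite /coset_app; case: x => C /= /lcosetsP[x _ ->] xg Lt.
have xr := mem_repr g xg; move: (repr _) xr => r.
have app_coset y : y \in (x *: galc_fix L)%g -> galc_app y t = galc_app x t.
  case/lcosetP=> u; rewrite inE => Lu ->; rewrite galc_appM.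
  by congr galc_app; apply: (fixed_gal (subvf L) Lu Lt).
by move=> xr; rewrite !app_coset.
Qed.

Variables (star : galX -> galX -> galX) (S : group_law star).

Definition galN : finGroupType := law_group S.

Definition gal_act : galc E -> galN -> galN :=
  @ltrans (galc E) (galc_fix_group L).

Definition hg_algebra : {vspace {ffun galN -> E}} :=
  ga_fixed gal_act [set: galN].

Definition hg_act (h : {ffun galN -> E}) (t : E) : E :=
  \sum_(x : galN) h x * coset_app x t.

(** [h_(1)(s) h_(2)(t)] *)
Definition hg_act2 (h : {ffun galN -> E}) (s t : E) : E :=
  \sum_(p : galN * galN) ga_comul h p * (coset_app p.1 s * coset_app p.2 t).

(** The image of [l (x) h] in [End_K(L)]. *)
Definition hg_can (l : E) (h : {ffun galN -> E}) : 'End(subvs_of L) :=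
  linfun (fun t : subvs_of L => vsproj L (l * hg_act h (vsval t))).

(** Bijectivity of [L (x)_K H -> End_K(L)] is expressed on the basis of
    [L (x)_K H] formed by the tensors of basis vectors.

    For a skew bracoid, all the fields hold as soon as the identity of [star]
    is the coset of the identity; conversely [hg_act1] forces this, and it is
    not a consequence of the axioms of a skew bracoid: for [u] in a group [G],
    left translations and [x y |-> x u^-1 y], with identity [u], form one. *)
Record hopf_galois : Prop := HopfGalois {
  hg_hopf : hopf_closed hg_algebra;
  hg_stable : {in hg_algebra & L, forall h t, hg_act h t \in L};
  hg_act1 : {in L, forall t, hg_act (ga_one E galN) t = t};
  hg_actM : {in hg_algebra & hg_algebra & L, forall a b t,
    hg_act (ga_mul a b) t = hg_act a (hg_act b t)};
  hg_act_unit : {in hg_algebra, forall h, hg_act h 1 = ga_counit h};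
  hg_act_mul : {in hg_algebra & L & L, forall h s t,
    hg_act h (s * t) = hg_act2 h s t};
  hg_bij : basis_of {:'End(subvs_of L)}
    [seq hg_can l h | l <- vbasis L, h <- vbasis hg_algebra]
}.

Definition hg_defect (h : {ffun galN -> E}) (t : E) : E :=
  hg_act h t - ga_counit h * t.

Fact hg_defect_is_linear h : linear (hg_defect h).
Proof.
move=> k s t; rewrite /hg_defect mulrDr scalerBr opprD addrACA; congr (_ + _).
  rewrite scaler_sumr -big_split; apply: eq_bigr => x _ /=.
  by rewrite /coset_app /galc_app linearP mulrDr scalerAr.
by rewrite scalerAr.
Qed.
HB.instance Definition _ h :=
  GRing.isLinear.Build K E E _ (hg_defect h) (hg_defect_is_linear h).

(** [L^V = {t in L | h(t) = eps(h) t for all h in V}] *)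
Definition hg_fixed_field (V : {vspace {ffun galN -> E}}) : {vspace E} :=
  (L :&: \bigcap_(h <- vbasis V) lker (linfun (hg_defect h)))%VS.

Lemma hg_fixed_fieldP (V : {vspace {ffun galN -> E}}) t :
  reflect (t \in L /\ {in V, forall h, hg_act h t = ga_counit h * t})
          (t \in hg_fixed_field V).
Proof.
have defectD h : (t \in lker (linfun (hg_defect h))) =
    (hg_act h t == ga_counit h * t).
  by rewrite memv_ker lfunE /= subr_eq0.
have -> : (t \in hg_fixed_field V) =
    (t \in L) && all (fun h => hg_act h t == ga_counit h * t) (vbasis V).
  rewrite memv_cap; congr andb.
  elim: (tval (vbasis V)) => [|h r IHr]; first by rewrite big_nil memvf.
  by rewrite big_cons memv_cap IHr defectD.
apply: (iffP andP) => [[Lt /allP Vt] | [Lt Vt]]; split=> //.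
  move=> h Vh; have -> : h = \sum_i coord (vbasis V) i h *: (vbasis V)`_i.
    exact: coord_vbasis.
  move: (fun i => coord (vbasis V) i h) => c.
  rewrite /hg_act /ga_counit mulr_suml; under eq_bigr => x _.
    rewrite sum_ffunE mulr_suml; under eq_bigr => i _ do rewrite ffunE.
    over.
  rewrite exchange_big /=; under [RHS]eq_bigr => x _.
    rewrite sum_ffunE mulr_suml; under eq_bigr => i _ do rewrite ffunE.
    over.
  rewrite [RHS]exchange_big; apply: eq_bigr => i _ /=.
  under eq_bigr do rewrite -scalerAl; under [RHS]eq_bigr do rewrite -scalerAl.
  rewrite -!scaler_sumr -mulr_suml; congr (_ *: _); apply/eqP.
  by apply: Vt; rewrite mem_nth ?size_tuple.
by apply/allP=> h /vbasis_mem Vh; apply/eqP/Vt.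
Qed.

(** For a subspace of a field, [is_aspace] amounts to being a subfield that
    contains [K]. *)
Definition intermediate_field (F : {vspace E}) : bool :=
  is_aspace F && (F <= L)%VS.

Definition realizable (F : {vspace E}) : Prop :=
  intermediate_field F /\
  exists2 V, hopf_subalgebra hg_algebra V & F = hg_fixed_field V.

Definition ideal_field (Y : {set galN}) : {vspace E} :=
  hg_fixed_field (ga_fixed gal_act Y).

End HopfGalois.

Arguments galN {K E L star} S.
Arguments gal_act {K E L star} S g x.
Arguments hg_algebra {K E L star} S.
Arguments hg_act {K E L star} S h t.
Arguments hg_can {K E L star} S l h.
Arguments hopf_galois {K E L star} S.
Arguments hg_fixed_field {K E L star} S V.
Arguments realizable {K E L star} S F.
Arguments ideal_field {K E L star} S Y.

(* Main.v *)
Require Import Defs.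
From mathcomp Require Import all_boot all_fingroup all_algebra all_field.

Set Implicit Arguments.
Unset Strict Implicit.
Unset Printing Implicit Defensive.

Import GroupScope GRing.Theory.
Local Open Scope ring_scope.

(* Write [gamma] for the gamma-function.  [E[Y]^G] consists of the [a] supported
   on [Y] with [a (gamma g x) = g (a x)], and by Galois descent it spans [E[Y]]
   over [E]; hence [t] is in [L^Y] iff [x(t) = t] for all [x] in [Y].  As [Y] is
   stable under [gamma], [G_Y] is the set of [g] whose coset lies in [Y], so
   [L^Y = E^(G_Y)], and injectivity and (4) follow from the Galois
   correspondence.  Conversely, the [E]-span of a Hopf subalgebra [V] of
   [E[X]^G] is a subcoalgebra of [E[X]], hence equals [E[Y]] where [Y] is the
   union of the supports of the elements of [V], and [V] has the same fixed field
   as [E[Y]^G].  For (3), the adjoint action of [h] on [a] has coefficient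
   [sum_x h(x) a(x^-1 z x)] at [z] (up to inverting [x]); since [E[X]^G] spans
   [E[X]], this vanishes for all [h] only if each [a(x^-1 z x)] does. *)

(** * The [gamma]-function, left ideals and their stabilizers *)

Section Gamma.

Variables (gT nT : finGroupType) (act : gT -> nT -> nT).
Hypothesis actB : skew_bracoid act.

Lemma gamma1 (x : nT) : gamma act 1%g x = x.
Proof. by rewrite /gamma !(sb_act1 actB) invg1 mul1g. Qed.

Lemma gamma_mul (g : gT) (x y : nT) :
  gamma act g (x * y)%g = (gamma act g x * gamma act g y)%g.
Proof. by rewrite /gamma (sb_rel actB) !mulgA. Qed.

Lemma gamma_one (g : gT) : gamma act g 1%g = 1%g.
Proof. by rewrite /gamma mulVg. Qed.

Lemma gamma_inv (g : gT) (x : nT) :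
  gamma act g x^-1%g = (gamma act g x)^-1%g.
Proof.
by apply/(mulgI (gamma act g x)); rewrite -gamma_mul !mulgV gamma_one.
Qed.

Lemma act_gamma (g : gT) (x : nT) : act g x = (act g 1 * gamma act g x)%g.
Proof. by rewrite /gamma mulKVg. Qed.

Lemma gammaM (g h : gT) (x : nT) :
  gamma act (g * h)%g x = gamma act g (gamma act h x).
Proof.
rewrite {3}/gamma gamma_mul gamma_inv /gamma !(sb_actM actB).
by rewrite invMg invgK mulgA mulgK.
Qed.

Lemma gammaK (g : gT) : cancel (gamma act g) (gamma act g^-1%g).
Proof. by move=> x; rewrite -gammaM mulVg gamma1. Qed.

Lemma gammaKV (g : gT) : cancel (gamma act g^-1%g) (gamma act g).
Proof. by move=> x; rewrite -gammaM mulgV gamma1. Qed.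

Lemma gamma_inj (g : gT) : injective (gamma act g).
Proof. exact: can_inj (gammaK g). Qed.

Lemma left_idealP (M : {group nT}) :
  reflect (forall g x, (gamma act g x \in M) = (x \in M)) (left_ideal act M).
Proof.
apply: (iffP eqP) => [defM | gammaM_M].
  have stabM g x : x \in M -> gamma act g x \in M.
    by move=> Mx; rewrite -{1}defM; apply: imset2_f; rewrite ?inE.
  move=> g x; apply/idP/idP=> [/(stabM g^-1%g) | /stabM //].
  by rewrite gammaK.
apply/setP=> y; apply/imset2P/idP=> [[g x _ Mx ->] | My].
  by rewrite gammaM_M.
by exists 1%g y; rewrite ?inE ?gamma1.
Qed.

Lemma ideal_stabE (M : {group nT}) :
  left_ideal act M -> ideal_stab act M = [set g | act g 1%g \in M].
Proof.
move/left_idealP=> gammaM_M; apply/setP=> g; rewrite !inE.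
apply/forall_inP/idP=> [-> // | Mg x Mx].
by rewrite act_gamma groupM ?gammaM_M.
Qed.

Lemma ideal_stab_group_set (M : {set nT}) : group_set (ideal_stab act M).
Proof.
apply/group_setP; split=> [|g h]; rewrite !inE.
  by apply/forall_inP=> x Mx; rewrite (sb_act1 actB).
move=> /forall_inP gM /forall_inP hM; apply/forall_inP=> x Mx.
by rewrite (sb_actM actB) gM ?hM.
Qed.

End Gamma.

Arguments gamma_inj {gT nT act} actB g [x1 x2].

(** * Dual coordinates for the Galois group, and the trace from E to K *)

Section GaloisCoordinates.

Variables (K : fieldType) (E : splittingFieldType K).

(** The matrix of the values g(w_j) is invertible, by independence of automorphisms. Here [e] is the
    family w and [d] is the column of the inverse matrix indexed by the identity. *)
Lemma galc_coordinates :
  exists n (d e : 'I_n -> E),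
    forall g : galc E, \sum_i d i * galc_app g (e i) = (g == 1%g)%:R.
Proof.
have [w _ [uM _ _]] := gal_matrix [set: gal_of {:E}%AS].
set M := (\matrix_(i, j) _) in uM.
pose k := enum_rank_in (in_setT (1%g : gal_of {:E})) (1%g : gal_of {:E}).
exists _, (fun i => (invmx M) i k), (fun i => tnth w i) => g.
pose r := enum_rank_in (in_setT (1%g : gal_of {:E})) (g : gal_of {:E}).
have := congr1 (fun A : 'M_ _ => A r k) (mulmxV uM); rewrite !mxE => def1.
transitivity ((r == k)%:R : E).
  rewrite -def1; apply: eq_bigr => i _; rewrite mulrC mxE.
  by rewrite enum_rankK_in ?inE.
congr (_%:R); congr nat_of_bool.
by rewrite (can_in_eq (enum_rankK_in _)) ?inE.
Qed.

Hypothesis galEK : galois 1%VS {:E}%VS.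

Definition gal_trace (u : E) : E := \sum_(g : galc E) galc_app g u.

Lemma galc_app_sum (g : galc E) (I : finType) (P : pred I) (F : I -> E) :
  galc_app g (\sum_(i | P i) F i) = \sum_(i | P i) galc_app g (F i).
Proof. by rewrite /galc_app linear_sum. Qed.

Lemma galc_app_prod (g : galc E) (s t : E) :
  galc_app g (s * t) = galc_app g s * galc_app g t.
Proof. by rewrite /galc_app rmorphM. Qed.

Lemma gal_setT : 'Gal({:E} / 1%VS)%g = [set: gal_of {:E}].
Proof.
apply/eqP; rewrite eqEsubset subsetT -[in X in _ \subset X]/(1%AS : {vspace E}).
by rewrite galois_connection ?sub1v // sub1v.
Qed.

Lemma gal_trace_in1 (u : E) : exists k : K, gal_trace u = k%:A.
Proof.
apply/vlineP; have /galois_fixedField <- := galEK.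
apply/fixedFieldP=> [|h _]; first exact: memvf.
have -> : h (gal_trace u) = \sum_g galc_app ((h : galc E) * g)%g u.
  by rewrite linear_sum; apply: eq_bigr => g _; rewrite galc_appM.
by rewrite /gal_trace [RHS](reindex_inj (mulgI (h : galc E))).
Qed.

(** Summing the coordinate relations over all g gives sum_i d_i tr(e_i) = 1, so in every
    characteristic some tr(e_i) is nonzero. It lies in K, so e_i can be rescaled by its inverse. *)
Lemma gal_trace_eq1 : exists u : E, gal_trace u = 1.
Proof.
have [n [d [e de]]] := galc_coordinates.
have sum_de : \sum_i d i * gal_trace (e i) = 1.
  under eq_bigr do rewrite mulr_sumr.
  rewrite exchange_big /= (bigD1 1%g) //= de eqxx big1 ?addr0 // => g.
  by rewrite de => /negPf->.
have [i nz_i] : exists i, gal_trace (e i) != 0.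
  apply/existsP; apply/existsPn => trace0.
  have /eqP := sum_de; rewrite big1 ?(eq_sym 0) ?oner_eq0 // => i _.
  by move/(_ i): trace0; rewrite negbK => /eqP->; rewrite mulr0.
have [k def_k] := gal_trace_in1 (e i); exists (k^-1 *: e i).
have -> : gal_trace (k^-1 *: e i) = k^-1 *: gal_trace (e i).
  by rewrite scaler_sumr; apply: eq_bigr => g _; rewrite /galc_app linearZ.
rewrite def_k scalerA mulVf ?scale1r //.
by apply: contraNneq nz_i => k0; rewrite def_k k0 scale0r.
Qed.

End GaloisCoordinates.

(** * Coefficient formulas in the group algebra, and contraction of its coproduct *)

Section GroupAlgebraTheory.

Variables (K : fieldType) (E : fieldExtType K) (N : finGroupType).
Implicit Types (x y z : N) (a b : {ffun N -> E}) (V : {vspace {ffun N -> E}}).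

Lemma ga_mulE a b z : ga_mul a b z = \sum_x a x * b (x^-1 * z)%g.
Proof.
rewrite ffunE (reindex_onto (fun x => (x, (x^-1 * z)%g)) fst) /=; last first.
  by case=> x y /= /eqP <-; rewrite mulKg.
by apply: eq_bigl => x; rewrite mulKVg !eqxx.
Qed.

Lemma ga_mulEr a b z : ga_mul a b z = \sum_y a (z * y^-1)%g * b y.
Proof.
rewrite ga_mulE (reindex_inj (inj_comp (mulgI z) (@invg_inj _))) /=.
by apply: eq_bigr => y _; rewrite invMg invgK mulgKV.
Qed.

Lemma sum_ga_delta (x : N) (phi : N -> E) :
  \sum_y ga_delta E x y * phi y = phi x.
Proof.
rewrite (bigD1 x) //= ffunE eqxx mul1r big1 ?addr0 // => y /negPf.
by rewrite ffunE => ->; rewrite mul0r.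
Qed.

Lemma ga_mul_deltal x b z : ga_mul (ga_delta E x) b z = b (x^-1 * z)%g.
Proof. by rewrite ga_mulE sum_ga_delta. Qed.

Lemma ga_mul_deltar a y z : ga_mul a (ga_delta E y) z = a (z * y^-1)%g.
Proof.
by rewrite ga_mulEr; under eq_bigr do rewrite mulrC; rewrite sum_ga_delta.
Qed.

Lemma ga_antipode_delta x : ga_antipode (ga_delta E x) = ga_delta E x^-1%g.
Proof. by apply/ffunP=> y; rewrite !ffunE (inv_eq invgK). Qed.

Lemma ga_comulE a p : ga_comul a p = a p.1 *+ (p.1 == p.2).
Proof.
case: p => y z; rewrite sum_ffunE (bigD1 y) //= big1 ?addr0 => [|x].
  by rewrite !ffunE /= eqxx mul1r mulr_natr eq_sym.
by rewrite !ffunE /= eq_sym => /negPf->; rewrite mul0r mulr0.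
Qed.

Lemma sum_ga_comul a (phi : N * N -> E) :
  \sum_p ga_comul a p * phi p = \sum_x a x * phi (x, x).
Proof.
transitivity (\sum_x \sum_y ga_comul a (x, y) * phi (x, y)).
  by rewrite pair_bigA; apply: eq_bigr => -[].
apply: eq_bigr => x _; rewrite (bigD1 x) //= ga_comulE eqxx big1 ?addr0 // => y.
by rewrite ga_comulE /= eq_sym => /negPf->; rewrite mul0r.
Qed.

Lemma ga_adlE h a z : ga_adl h a z = \sum_x h x * a (z ^ x)%g.
Proof.
rewrite /ga_adl sum_ffunE; under eq_bigr do rewrite ffunE.
rewrite sum_ga_comul; apply: eq_bigr => x _ /=.
by rewrite ga_antipode_delta ga_mul_deltar ga_mul_deltal invgK conjgE mulgA.
Qed.

Lemma ga_adrE h a z : ga_adr h a z = \sum_x h x * a (z ^ x^-1)%g.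
Proof.
rewrite /ga_adr sum_ffunE; under eq_bigr do rewrite ffunE.
rewrite sum_ga_comul; apply: eq_bigr => x _ /=.
by rewrite ga_antipode_delta ga_mul_deltar ga_mul_deltal conjgE !invgK mulgA.
Qed.

Lemma ga_tensor_in V a b :
  a \in V -> b \in V -> ga_tensor a b \in tensor_square V.
Proof.
move=> /coord_vbasis-> /coord_vbasis->.
set f := coord _; have -> : forall c d : 'I_(\dim V) -> K,
    ga_tensor (\sum_i c i *: (vbasis V)`_i) (\sum_j d j *: (vbasis V)`_j) =
    \sum_i \sum_j (c i * d j) *: ga_tensor (vbasis V)`_i (vbasis V)`_j.
  move=> c d; apply/ffunP=> p; rewrite !(ffunE, sum_ffunE) mulr_suml.
  apply: eq_bigr => i _; rewrite !sum_ffunE mulr_sumr; apply: eq_bigr => j _.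
  by rewrite !ffunE -scalerAl -scalerAr scalerA.
apply: rpred_sum => i _; apply: rpred_sum => j _; apply/rpredZ/memv_span.
by apply/allpairsP; exists ((vbasis V)`_i, (vbasis V)`_j);
  rewrite !mem_nth ?size_tuple.
Qed.

(* Contracting the second tensor factor at [x] maps [ga_comul a] to
   [a x . x] and [V (x) V] into the [E]-span of [V]; the latter is described
   through the linear forms [phi] vanishing on [V]. *)
Lemma ga_comul_annihilator V a (phi : N -> E) x :
    ga_comul a \in tensor_square V ->
    {in V, forall b, \sum_y b y * phi y = 0} -> a x != 0 ->
  phi x = 0.
Proof.
move=> Va V0 nz_ax; suffices /eqP : a x * phi x = 0.
  by rewrite mulf_eq0 (negPf nz_ax) => /eqP.
have <- : \sum_y ga_comul a (y, x) * phi y = a x * phi x.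
  rewrite (bigD1 x) //= ga_comulE eqxx big1 ?addr0 // => y.
  by rewrite ga_comulE => /negPf->; rewrite mul0r.
move: Va; rewrite /tensor_square; set s := (X in <<X>>%VS) => Va.
rewrite (@coord_span _ _ _ (in_tuple s) _ Va).
under eq_bigr do rewrite sum_ffunE mulr_suml.
rewrite exchange_big big1 //= => i _.
have /allpairsP[[b c] [/vbasis_mem Vb _ ->]] : s`_i \in s by rewrite mem_nth.
under eq_bigr do rewrite !ffunE /= -scalerAl mulrAC.
by rewrite -scaler_sumr -mulr_suml V0 // mul0r scaler0.
Qed.

End GroupAlgebraTheory.

(** * Galois descent for E[M]^G and its Hopf algebra structure *)

Section DescentTheory.

Variables (K : fieldType) (E : splittingFieldType K) (N : finGroupType).
Variable act : galc E -> N -> N.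
Hypothesis actB : skew_bracoid act.
Hypothesis galEK : galois 1%VS {:E}%VS.
Implicit Types (x y z : N) (a b h : {ffun N -> E}) (M : {group N}).
Implicit Type g : galc E.

Let fix_gamma a := forall g x, a (gamma act g x) = galc_app g (a x).

Lemma ga_act_gamma g a x : ga_act act g a (gamma act g x) = galc_app g (a x).
Proof.
by rewrite ffunE (big_pred1 x) // => y; rewrite /= (inj_eq (gamma_inj actB g)).
Qed.

Lemma ga_fixed_gammaP (M : {set N}) a :
  reflect (fix_gamma a /\ (forall x, x \notin M -> a x = 0))
          (a \in ga_fixed act M).
Proof.
apply: (iffP (ga_fixedP act M a)) => -[Ga Ma]; split=> // g.
  by move=> x; rewrite -ga_act_gamma Ga.
by apply/ffunP=> y; rewrite -(gammaKV actB g y) ga_act_gamma [RHS]Ga.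
Qed.

Lemma ga_fixedS (A B : {set N}) :
  A \subset B -> (ga_fixed act A <= ga_fixed act B)%VS.
Proof.
move=> /subsetP sAB; apply/subvP=> a /ga_fixed_gammaP[Ga Aa].
by apply/ga_fixed_gammaP; split=> // x Bx; apply/Aa/(contra _ Bx)/sAB.
Qed.

(** The trace of c . x over G, that is, the sum of the g(c) . gamma(g)(x). *)
Definition ga_orbit x (c : E) : {ffun N -> E} :=
  [ffun y => \sum_(g | gamma act g x == y) galc_app g c].

Lemma ga_orbit_fixed M x c :
  left_ideal act M -> x \in M -> ga_orbit x c \in ga_fixed act M.
Proof.
move=> /(left_idealP actB) stabM Mx; apply/ga_fixed_gammaP; split=> [h y | y].
  rewrite !ffunE galc_app_sum (reindex_inj (mulgI h)) /=.
  by apply: eq_big => [g | g _]; rewrite ?galc_appM // gammaM //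
    (inj_eq (gamma_inj actB h)).
rewrite ffunE => My; apply: big_pred0 => g; apply: contraNF My => /eqP<-.
by rewrite stabM.
Qed.

Section Coordinates.

Variables (n : nat) (d e : 'I_n -> E).
Hypothesis de : forall g, \sum_i d i * galc_app g (e i) = (g == 1%g)%:R.

(** The [d i] isolate the term g = 1 of the orbit sums, which writes the group element x as an
    E-combination of fixed points. *)
Lemma ga_orbit_coordinates x y :
  \sum_i d i * ga_orbit x (e i) y = (x == y)%:R.
Proof.
under eq_bigr do rewrite ffunE mulr_sumr.
rewrite exchange_big /=; under eq_bigr do rewrite de.
rewrite -[x in RHS](gamma1 actB).
have [xy | xy] := eqVneq (gamma act 1%g x) y.
  rewrite (bigD1 1%g) ?xy //= big1 ?eqxx ?addr0 //.
  by move=> g /andP[_ /negPf->].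
rewrite big1 // => g /eqP gxy; case: eqP => // g1.
by rewrite -gxy g1 eqxx in xy.
Qed.

(** Letting g act on [ga_orbit_coordinates] twists the [d i] but not the orbit sums, which are
    fixed; the group element x becomes gamma(g)(x). *)
Lemma ga_orbit_twisted_coordinates M g x y : left_ideal act M -> x \in M ->
  \sum_i galc_app g (d i) * ga_orbit x (e i) y = (gamma act g x == y)%:R.
Proof.
move=> idM Mx; rewrite -(gammaKV actB g y) (inj_eq (gamma_inj actB g)).
rewrite -ga_orbit_coordinates.
transitivity (galc_app g (\sum_i d i * ga_orbit x (e i) (gamma act g^-1%g y))).
  rewrite galc_app_sum; apply: eq_bigr => i _; rewrite galc_app_prod.
  by have /ga_fixed_gammaP[-> _] := ga_orbit_fixed (e i) idM Mx.
by rewrite ga_orbit_coordinates /galc_app rmorph_nat.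
Qed.

End Coordinates.

(* Galois descent: [E[M]^G] spans [E[M]] over [E]. *)
Lemma ga_fixed_annihilator M (phi : N -> E) x : left_ideal act M ->
    {in ga_fixed act M, forall a, \sum_y a y * phi y = 0} -> x \in M ->
  phi x = 0.
Proof.
move=> idM M0 Mx; have [n [d [e de]]] := galc_coordinates E.
transitivity (\sum_i d i * \sum_y ga_orbit x (e i) y * phi y); last first.
  by rewrite big1 // => i _; rewrite M0 ?mulr0 ?ga_orbit_fixed.
under [RHS]eq_bigr do rewrite mulr_sumr.
rewrite exchange_big -[LHS]sum_ga_delta; apply: eq_bigr => y _ /=.
under eq_bigr do rewrite mulrA.
by rewrite -mulr_suml (ga_orbit_coordinates de) ffunE eq_sym.
Qed.

(* For [x] in [M], [1 . x] is the sum of the [d i . ga_orbit x (e i)]; averaging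
   [u . ga_comul a] over [G], where [u] has trace 1, turns the coefficients
   [u a(x) d(i) d(j)] into traces, which lie in [K]. *)
Lemma ga_comul_fixed M a : left_ideal act M -> a \in ga_fixed act M ->
  ga_comul a \in tensor_square (ga_fixed act M).
Proof.
move=> idM /ga_fixed_gammaP[Ga Ma].
have [n [d [e de]]] := galc_coordinates E; have [u tr_u] := gal_trace_eq1 galEK.
pose t x i j := [ffun p => gal_trace (u * a x * d i * d j) *
                   ga_tensor (ga_orbit x (e i)) (ga_orbit x (e j)) p].
suffices -> : ga_comul a = \sum_(x in M) \sum_i \sum_j t x i j.
  apply: rpred_sum => x Mx; apply: rpred_sum => i _; apply: rpred_sum => j _.
  have [k tr_k] := gal_trace_in1 galEK (u * a x * d i * d j).
  have -> : t x i j =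
      k *: ga_tensor (ga_orbit x (e i)) (ga_orbit x (e j)).
    by apply/ffunP=> p; rewrite [LHS]ffunE tr_k mulr_algl [RHS]ffunE.
  by apply/rpredZ/ga_tensor_in; apply: ga_orbit_fixed.
apply/ffunP=> -[y z]; rewrite ga_comulE /=.
(* Once the traces are expanded over g, the sums over i and j collapse to the two indicators given
   by [ga_orbit_twisted_coordinates]. *)
transitivity (\sum_(x in M) \sum_g galc_app g (u * a x) *
    ((gamma act g x == y)%:R * (gamma act g x == z)%:R)); last first.
  rewrite sum_ffunE; apply: eq_bigr => x Mx.
  transitivity (\sum_g galc_app g (u * a x) *
     (\sum_i \sum_j galc_app g (d i) * ga_orbit x (e i) y *
        (galc_app g (d j) * ga_orbit x (e j) z))).
    apply: eq_bigr => g _.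
    rewrite -(ga_orbit_twisted_coordinates de g y idM Mx).
    rewrite -(ga_orbit_twisted_coordinates de g z idM Mx).
    rewrite mulr_suml; congr (_ * _); apply: eq_bigr => i _.
    by rewrite mulr_sumr.
  under [LHS]eq_bigr => g _ do rewrite mulr_sumr.
  rewrite exchange_big sum_ffunE; apply: eq_bigr => i _ /=.
  under eq_bigr do rewrite mulr_sumr.
  rewrite exchange_big sum_ffunE; apply: eq_bigr => j _ /=.
  rewrite [RHS]ffunE [ga_tensor _ _ _]ffunE mulr_suml; apply: eq_bigr => g _ /=.
  by rewrite !galc_app_prod -!mulrA; congr (_ * (_ * (_ * _))); rewrite mulrCA.
rewrite exchange_big /=.
transitivity (\sum_g galc_app g u * (a y *+ (y == z))).
  by rewrite -mulr_suml -/(gal_trace u) tr_u mul1r.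
(* Since a vanishes off M, the sum may run over all x. Only x = gamma(g^-1)(y) contributes, and
   there g(a(x)) = a(y) by invariance. *)
apply: eq_bigr => g _; rewrite big_rmcond => [|x /Ma->]; last first.
  by rewrite mulr0 /galc_app rmorph0 mul0r.
rewrite (bigD1 (gamma act g^-1%g y)) //= gammaKV // eqxx mul1r big1 ?addr0.
  by rewrite galc_app_prod -Ga gammaKV // mulr_natr mulrnAr.
move=> x; rewrite -[x == _](inj_eq (gamma_inj actB g)) gammaKV // => /negPf->.
by rewrite mul0r mulr0.
Qed.

Lemma hopf_closed_ga_fixed M :
  left_ideal act M -> hopf_closed (ga_fixed act M).
Proof.
move=> idM; split.
- apply/ga_fixed_gammaP; split=> [g x | x Mx]; rewrite !ffunE.
    rewrite -[X in gamma act g x == X](gamma_one act g).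
    by rewrite (inj_eq (gamma_inj actB g)) /galc_app rmorph_nat.
  by case: eqP Mx => // ->; rewrite group1.
- move=> a b /ga_fixed_gammaP[Ga Ma] /ga_fixed_gammaP[Gb Mb].
  apply/ga_fixed_gammaP; split=> [g z | z Mz]; rewrite !ga_mulE.
    rewrite galc_app_sum (reindex_inj (gamma_inj actB g)).
    apply: eq_bigr => x _.
    by rewrite -gamma_inv // -gamma_mul // Ga Gb galc_app_prod.
  apply: big1 => x _; have [Mx | /Ma->] := boolP (x \in M); last exact: mul0r.
  by rewrite Mb ?mulr0 // groupMl ?groupV.
- move=> a /ga_fixed_gammaP[Ga Ma]; apply/ga_fixed_gammaP.
  by split=> [g x | x Mx]; rewrite !ffunE -?gamma_inv // Ma // groupV.
- by move=> a; apply: ga_comul_fixed.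
Qed.

Lemma hopf_subalgebra_ga_fixed M : left_ideal act M ->
  hopf_subalgebra (ga_fixed act [set: N]) (ga_fixed act M).
Proof.
move=> idM; split; first exact: ga_fixedS (subsetT M).
exact: hopf_closed_ga_fixed.
Qed.

(** * Normal Hopf subalgebras and ideals *)

Lemma gammaJ g x y : gamma act g (x ^ y)%g = (gamma act g x ^ gamma act g y)%g.
Proof. by rewrite !conjgE !gamma_mul // gamma_inv. Qed.

Lemma left_idealT : left_ideal act [set: N]%G.
Proof. by apply/(left_idealP actB) => g x; rewrite !inE. Qed.

Lemma normal_ga_fixedP M : left_ideal act M ->
  normal_hopf_subalgebra (ga_fixed act [set: N]) (ga_fixed act M) <->
  ideal act M.
Proof.
move=> idM; rewrite /ideal idM /=; split=> [[_ adM] | /andP[_ nMT]].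
  rewrite /normal subsetT; apply/subsetP=> x _; rewrite -groupV inE.
  apply/subsetP=> _ /imsetP[y My ->]; apply: contraT => Mxy.
  (* For every h, the left adjoint action of h on a stays in E[M]^G, so it vanishes at the conjugate
     assumed to lie outside M. Descent for the whole of N then isolates the term at x, which is
     a(y). *)
  have a0 a : a \in ga_fixed act M -> a y = 0.
    move=> Ma; rewrite -(conjgKV x y).
    pose phi z := a ((y ^ x^-1) ^ z)%g.
    apply: (@ga_fixed_annihilator [set: N]%G phi x left_idealT) => [h Hh |].
      rewrite -ga_adlE; have [/ga_fixed_gammaP[_ ->] //] := adM h a Hh Ma.
    by rewrite inE.
  (* The form reading off the coefficient at y now annihilates E[M]^G, so by descent it vanishes at
     y itself, which is absurd. *)
  have /eqP : ga_delta E y y = 0.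
    apply: (ga_fixed_annihilator idM _ My) => a Ma.
    by under eq_bigr do rewrite mulrC; rewrite sum_ga_delta a0.
  by rewrite ffunE eqxx oner_eq0.
split=> [|h a /ga_fixed_gammaP[Gh _] /ga_fixed_gammaP[Ga Ma]].
  exact: hopf_subalgebra_ga_fixed.
have MJ x z : (z ^ x \in M)%g = (z \in M).
  by rewrite memJ_norm // (subsetP nMT) ?inE.
split; apply/ga_fixed_gammaP; split=> [g z | z Mz]; rewrite ?ga_adlE ?ga_adrE.
- rewrite galc_app_sum (reindex_inj (gamma_inj actB g)); apply: eq_bigr => x _.
  by rewrite -gammaJ Gh Ga galc_app_prod.
- by apply: big1 => x _; rewrite Ma ?mulr0 ?MJ.
- rewrite galc_app_sum (reindex_inj (gamma_inj actB g)); apply: eq_bigr => x _.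
  by rewrite -gamma_inv // -gammaJ Gh Ga galc_app_prod.
- by apply: big1 => x _; rewrite Ma ?mulr0 ?MJ.
Qed.

(** * From a Hopf subalgebra to the left ideal of its support *)

Section HopfSubalgebra.

Variable V : {vspace {ffun N -> E}}.
Hypothesis hopfV : hopf_subalgebra (ga_fixed act [set: N]) V.

Definition hopf_support : {set N} :=
  [set x | ~~ (V <= lker (linfun (ga_coef (E := E) x)))%VS].

Lemma hopf_supportP x :
  reflect (exists2 a, a \in V & a x != 0) (x \in hopf_support).
Proof.
rewrite inE; apply: (iffP (@subvPn _ _ _ _)) => -[a Va ax]; exists a => //;
  by move: ax; rewrite memv_ker lfunE.
Qed.

(** Dual form of the fact that V spans E[Y] over E, with Y the support. It is the counterpart of
    [ga_fixed_annihilator], with the coproduct in place of descent. *)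
Lemma hopf_support_annihilator (phi : N -> E) x :
    {in V, forall a, \sum_y a y * phi y = 0} -> x \in hopf_support ->
  phi x = 0.
Proof.
have [_ [_ _ _ comulV]] := hopfV => V0 /hopf_supportP[a Va].
exact: ga_comul_annihilator (comulV a Va) V0.
Qed.

Lemma hopf_support_group_set : group_set hopf_support.
Proof.
have [_ [V1 VM _ _]] := hopfV.
apply/group_setP; split=> [|x y Vx /hopf_supportP[b Vb nz_by]].
  by apply/hopf_supportP; exists (ga_one E N); rewrite ?ffunE ?eqxx ?oner_eq0.
apply: contraNT nz_by => Vxy; rewrite -[y](mulKg x); apply/eqP.
(* Pairing a with this form gives the coefficient of the product of a and b at xy, which is zero if
   xy is outside the support; its value at x is b(y). *)
pose phi u := b (u^-1 * (x * y))%g.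
apply: (@hopf_support_annihilator phi x) => // a Va; rewrite -ga_mulE.
apply/eqP; apply: contraNT Vxy => nz_ab; apply/hopf_supportP.
by exists (ga_mul a b); rewrite ?VM.
Qed.
Canonical hopf_support_group := Group hopf_support_group_set.

Lemma left_ideal_hopf_support : left_ideal act hopf_support_group.
Proof.
have [sVH _] := hopfV; have suppV g x : x \in hopf_support ->
    gamma act g x \in hopf_support.
  case/hopf_supportP=> a Va nz_ax; apply/hopf_supportP; exists a => //.
  have /ga_fixed_gammaP[-> _] := subvP sVH a Va.
  by rewrite /galc_app fmorph_eq0.
apply/(left_idealP actB) => g x; apply/idP/idP=> [/(suppV g^-1%g) | /suppV //].
by rewrite gammaK.
Qed.

End HopfSubalgebra.

End DescentTheory.

(** * The Galois correspondence for the group under composition of maps *)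

Section GaloisOpposite.

Variables (K : fieldType) (E : splittingFieldType K).
Implicit Type A : {group galc E}.

Lemma galc_group_set A : group_set (A : {set gal_of {:E}}).
Proof.
apply/group_setP; split=> [|g h Ag Ah]; first exact: (group1 A).
by have := @groupM (galc E) A h g Ah Ag.
Qed.

Lemma gal_galc_fixed_field A :
  'Gal({:E} / galc_fixed_field A)%g = A :> {set gal_of {:E}}.
Proof. exact: (gal_fixedField (Group (galc_group_set A))). Qed.

Lemma galc_conjg (x g : galc E) :
  (x ^ g)%g = ((x : gal_of {:E}) ^ (g : gal_of {:E})^-1)%g.
Proof.
rewrite [RHS]conjgE invgK mulgA.
by have -> : (x ^ g)%g = ((g : gal_of {:E}) * x * (g : gal_of {:E})^-1)%g by [].
Qed.

(** Conjugation by g in one group is conjugation by g^-1 in its opposite, so both have the same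
    normal subgroups and the fundamental theorem of Galois theory carries over. *)
Lemma galois_galc_fixed_fieldP A : galois 1%VS {:E}%VS ->
  galois 1%VS (galc_fixed_field A) <-> (A <| [set: galc E])%g.
Proof.
move=> galEK; pose B := Group (galc_group_set A).
have -> : (A <| [set: galc E])%g = (B <| [set: gal_of {:E}])%g.
  rewrite /normal !subsetT /=.
  apply/subsetP/subsetP=> nA g _; rewrite inE;
    apply/subsetP=> _ /imsetP[x Ax ->].
    rewrite -[g]invgK -(galc_conjg x (g : gal_of {:E})^-1%g).
    by rewrite (@memJ_norm (galc E)) // nA ?inE.
  by rewrite -[_ \in A]/(_ \in B) galc_conjg memJ_norm // nA ?inE.
split=> [/and3P[_ _ nK] | nB]; last first.
  by apply: (@normal_fixedField_galois _ _ _ 1%AS galEK B); rewrite gal_setT.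
rewrite -gal_setT -[B : {set _}]gal_galc_fixed_field.
apply: (@normalField_normal _ _ {:E}%AS 1%AS (fixedField_aspace B) _ nK).
by rewrite sub1v subvf.
Qed.

End GaloisOpposite.

(** * Fixed fields of left ideals and of Hopf subalgebras *)

Section Correspondence.

Variables (K : fieldType) (E : splittingFieldType K).
Hypothesis galEK : galois 1%VS {:E}%VS.
Variables (L : {subfield E}) (star : galX L -> galX L -> galX L).
Variable S : group_law star.
Hypotheses (bracoidGX : skew_bracoid (gal_act S)) (hgH : hopf_galois S).
Implicit Types (x : galN S) (Y Z : {group galN S}).

Local Notation act := (gal_act S).
Local Notation Gal1 x := (val (x : galX L)).

(** By [hg_act1] the unit of the Hopf algebra acts trivially on L, so any representative of the
    coset that is neutral for [star] fixes L. *)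
Lemma val_one : Gal1 (1%g : galN S) = galc_fix L.
Proof.
have [r rV] : exists r, r \in Gal1 (1%g : galN S).
  case: (1%g : galN S) => C /= /lcosetsP[x _ ->].
  by exists x; apply: lcoset_refl.
have Lr : r \in galc_fix L.
  rewrite inE gal_kHom ?subvf //; apply/kAHomP=> t Lt.
  rewrite -[RHS](hg_act1 hgH Lt) -[LHS](coset_appE rV Lt).
  exact/esym/(sum_ga_delta 1%g (fun x => coset_app x t)).
move: rV; case: (1%g : galN S) => C /= /lcosetsP[x _ ->] /lcoset_eqP <-.
exact: lcoset_id.
Qed.

Lemma coset_app_act g (t : E) :
  t \in L -> coset_app (act g 1%g) t = galc_app g t.
Proof.
move=> Lt; apply: coset_appE => //=.
by rewrite val_one mem_lcoset mulVg group1.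
Qed.

(** The two hypotheses say that V spans E[A] over E. The second is applied to the form x(t) - t,
    whose pairing with a is the defect of a at t. This serves both E[Y]^G and an arbitrary Hopf
    subalgebra. *)
Lemma hg_fixed_field_support (V : {vspace {ffun galN S -> E}})
    (A : {set galN S}) (t : E) :
    (forall a, a \in V -> forall x, x \notin A -> a x = 0) ->
    (forall phi : galN S -> E,
       {in V, forall a : {ffun galN S -> E}, \sum_x a x * phi x = 0} ->
       {in A, forall x, phi x = 0}) ->
  t \in hg_fixed_field S V <-> t \in L /\ {in A, forall x, coset_app x t = t}.
Proof.
move=> suppV annV.
have defect (a : {ffun galN S -> E}) : \sum_x a x * (coset_app x t - t) =
    hg_act S a t - ga_counit a * t.
  by rewrite mulr_suml -sumrB; apply: eq_bigr => x _; rewrite mulrBr.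
split=> [/hg_fixed_fieldP[Lt Vt] | [Lt At]].
  split=> // x Ax; apply/eqP; rewrite -subr_eq0; apply/eqP.
  apply: (annV (fun x => coset_app x t - t)) => // a Va.
  by rewrite defect Vt ?subrr.
apply/hg_fixed_fieldP; split=> // a Va.
apply/eqP; rewrite -subr_eq0 -defect; apply/eqP/big1 => x _.
have [Ax | Ax] := boolP (x \in A); first by rewrite At ?subrr ?mulr0.
by rewrite (suppV a) ?mul0r.
Qed.

Lemma ideal_fieldP Y (t : E) : left_ideal act Y ->
  t \in ideal_field S Y <-> t \in L /\ {in Y, forall x, coset_app x t = t}.
Proof.
move=> idY; apply: hg_fixed_field_support => [a | phi Y0 x Yx].
  by case/(ga_fixed_gammaP bracoidGX).
exact: (ga_fixed_annihilator bracoidGX idY Y0).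
Qed.

Lemma ideal_field_galois Y : left_ideal act Y ->
  ideal_field S Y = galc_fixed_field (ideal_stab act Y).
Proof.
move=> idY; apply/vspaceP=> t; apply/idP/idP=> [/(ideal_fieldP t idY)[Lt Yt] |].
  apply/fixedFieldP=> [|g]; first exact: memvf.
  by rewrite (ideal_stabE bracoidGX idY) inE => /Yt; rewrite coset_app_act.
case/mem_fixedFieldP=> _ fix_t.
have stab_t g : act g 1%g \in Y -> galc_app g t = t.
  by move=> Yg; apply: fix_t; rewrite (ideal_stabE bracoidGX idY) inE.
apply/(ideal_fieldP t idY).
(* G' lies in G_Y because it fixes the identity coset, so t is fixed by Gal(E/L). *)
have Lt : t \in L.
  have /galois_fixedField <- : galois L {:E}.
    by apply: galoisS galEK; rewrite sub1v subvf.
  apply/fixedFieldP=> [|g Lg]; first exact: memvf.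
  apply: stab_t; have -> : act g 1%g = 1%g; last exact: group1.
  by apply/val_inj; rewrite /= val_one lcoset_id // inE.
split=> // x Yx; have [g xg] := sb_trans bracoidGX 1%g x.
by rewrite -xg coset_app_act // stab_t // xg.
Qed.

(** The fixed field determines G_Y by the Galois correspondence, and by transitivity Y is the orbit
    of the identity coset under G_Y. *)
Lemma ideal_field_inj Y Z : left_ideal act Y -> left_ideal act Z ->
  ideal_field S Y = ideal_field S Z -> Y = Z.
Proof.
move=> idY idZ; rewrite !ideal_field_galois // => eqYZ.
have eq_stab : ideal_stab act Y = ideal_stab act Z.
  have := gal_galc_fixed_field (Group (ideal_stab_group_set bracoidGX Y)).
  have := gal_galc_fixed_field (Group (ideal_stab_group_set bracoidGX Z)).
  by rewrite /= eqYZ => ->.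
apply/group_inj/setP=> x; have [g <-] := sb_trans bracoidGX 1%g x.
by have /setP/(_ g) := eq_stab; rewrite !(ideal_stabE bracoidGX) // !inE.
Qed.

Lemma realizable_ideal_field Y : left_ideal act Y ->
  realizable S (ideal_field S Y).
Proof.
move=> idY; split; last first.
  exists (ga_fixed act Y) => //.
  exact: (hopf_subalgebra_ga_fixed bracoidGX galEK idY).
rewrite /intermediate_field capvSl andbT ideal_field_galois //.
exact: (valP (fixedField_aspace _)).
Qed.

Lemma hopf_subalgebra_ideal_field (V : {vspace {ffun galN S -> E}}) :
    hopf_subalgebra (hg_algebra S) V ->
  exists2 Y : {group galN S},
    left_ideal act Y & hg_fixed_field S V = ideal_field S Y.
Proof.
move=> hopfV; pose Y := hopf_support_group hopfV.
have idY : left_ideal act Y by apply: left_ideal_hopf_support.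
exists Y => //; apply/vspaceP=> t.
have VY : t \in hg_fixed_field S V <->
    t \in L /\ {in Y, forall x, coset_app x t = t}.
  apply: hg_fixed_field_support => [a Va x Yx | phi V0 x Yx].
    by apply/eqP; apply: contraNT Yx => ax; apply/hopf_supportP; exists a.
  exact: (hopf_support_annihilator hopfV V0).
by apply/idP/idP=> [/VY/(ideal_fieldP t idY) | /(ideal_fieldP t idY)/VY].
Qed.

End Correspondence.

Theorem theorem5p9 (K : fieldType) (E : splittingFieldType K)
    (galEK : galois 1%VS {:E}%VS) (L : {subfield E})
    (star : galX L -> galX L -> galX L) (S : group_law star)
    (bracoidGX : skew_bracoid (gal_act S)) (hgH : hopf_galois S) :
  [/\ [/\ forall Y : {group galN S},
             left_ideal (gal_act S) Y -> realizable S (ideal_field S Y),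
           forall Y Z : {group galN S},
             left_ideal (gal_act S) Y -> left_ideal (gal_act S) Z ->
             ideal_field S Y = ideal_field S Z -> Y = Z
         & forall F : {vspace E}, realizable S F ->
             exists2 Y : {group galN S},
               left_ideal (gal_act S) Y & F = ideal_field S Y],
      forall Y : {group galN S}, left_ideal (gal_act S) Y ->
        ideal_field S Y = galc_fixed_field (ideal_stab (gal_act S) Y),
      forall Y : {group galN S}, left_ideal (gal_act S) Y ->
        normal_hopf_subalgebra (hg_algebra S) (ga_fixed (gal_act S) Y) <->
        ideal (gal_act S) Y
    & forall Y : {group galN S}, left_ideal (gal_act S) Y ->
        galois 1%VS (ideal_field S Y) <-> enhanced_left_ideal (gal_act S) Y].
Proof.
split; first split.
- by move=> Y; apply: realizable_ideal_field.
- by move=> Y Z; apply: ideal_field_inj.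
- move=> _ [_ [V hopfV ->]]; exact: hopf_subalgebra_ideal_field.
- by move=> Y; apply: ideal_field_galois.
- by move=> Y; apply: normal_ga_fixedP.
move=> Y idY; rewrite ideal_field_galois // /enhanced_left_ideal idY /=.
exact: (galois_galc_fixed_fieldP (Group (ideal_stab_group_set bracoidGX Y))).
Qed.
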